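(* For $1\le i\le k$, let $P_i$ be a lower-L-bounded poset with $\hat 0$. Then the wedge $P=\mathcal V(P_1,\ldots,P_k)$ is lower-L-bounded.
   Context: All posets are finite and nonempty. Let $[n]=\{1,\dots,n\}$; families of subsets of $[n]$ are ordered by inclusion. A poset $(P,\le)$ contains a poset $(P',\le')$ as a (weak) subposet if there is an injection $f:P'\to P$ such that $u\le' v$ implies $f(u)\le f(v)$. A family $\mathcal F\subseteq 2^{[n]}$ is $P$-free if it does not contain $P$ in this sense. $e(P)$ is the maximum integer $k\ge 0$ such that for all integers $n$ and $s$ the family $\binom{[n]}{s}\cup\binom{[n]}{s+1}\cup\cdots\cup\binom{[n]}{s+k-1}$ is $P$-free, where $\binom{[n]}{j}$ is the collection of $j$-element subsets of $[n]$ (empty if $j<0$ or $j>n$). The Lubell function of $\mathcal F\subseteq 2^{[n]}$ is the average over all $n!$ full (maximal) chains $\mathcal C$ of $2^{[n]}$ of $|\mathcal F\cap\mathcal C|$; equivalently $\bar h_n(\mathcal F)=\sum_{F\in\mathcal F}1/\binom{n}{|F|}$. $P$ is lower-L-bounded if for any $\beta\in(\frac12,1)$ and $\varepsilon>0$ there exists $N=N(\beta,\varepsilon)$ such that for all $n\ge N$, $\bar h_n(\mathcal F)\le e(P)+\varepsilon$ for all $P$-free families $\mathcal F$ of subsets of $[n]$ of sizes less than $\beta n$. An element $x$ of a poset $P$ is $\hat 0$ if $x\le p$ for all $p\in P$. For posets $P_1,\dots,P_k$ with $\hat 0$, the wedge $\mathcal V(P_1,\ldots,P_k)$ is the poset obtained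 from their disjoint union by identifying the $\hat 0$'s of the posets (elements of different $P_i$ other than the common $\hat 0$ are incomparable). *)

(* Defs.v *)
From HB Require Import structures.
From mathcomp Require Import all_boot all_order all_algebra.
From mathcomp Require Import boolp classical_sets reals.

Set Implicit Arguments.
Unset Strict Implicit.
Unset Printing Implicit Defensive.

Import Order.TTheory GRing.Theory Num.Theory.

Local Open Scope ring_scope.

(* The ground set [n] is 'I_n, and a family is an F : {set {set 'I_n}}. *)

(* A weak embedding: incomparable elements may get comparable images. *)
Definition contains_poset n (F : {set {set 'I_n}}) d (P : finPOrderType d) :=
  exists f : P -> {set 'I_n},
    [/\ injective f, forall p, f p \in F
      & forall u v : P, (u <= v)%O -> f u \subset f v].

Definition poset_free n (F : {set {set 'I_n}}) d (P : finPOrderType d) :=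
  ~ contains_poset F P.

Definition levels n (s : int) (k : nat) : {set {set 'I_n}} :=
  [set A : {set 'I_n} | s <= #|A|%:Z < s + k%:Z].

Definition levels_free d (P : finPOrderType d) (k : nat) :=
  forall (n : nat) (s : int), poset_free (levels n s k) P.

(* The default value 0 is only reached by the empty poset: see e_numberP. *)
Definition e_number d (P : finPOrderType d) : nat :=
  xget 0%N (fun k : nat => levels_free P k /\
                           forall k', levels_free P k' -> (k' <= k)%N).

Lemma levels_free0 d (P : finPOrderType d) : (0 < #|P|)%N -> levels_free P 0.
Proof.
move=> /card_gt0P[p _] n s [f [_ fF _]].
by have := fF p; rewrite inE addr0 => /andP[/le_lt_trans h /h]; rewrite ltxx.
Qed.

Lemma levels_free_bound d (P : finPOrderType d) k :
  levels_free P k -> (k <= #|P|)%N.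
Proof.
move=> Pk; rewrite leqNgt; apply/negP => ltPk.
apply: (Pk #|P| 0); exists (fun p => enum_rank @: [set q : P | (q <= p)%O]).
split=> [p q /(imset_inj enum_rank_inj)/setP pq|p|u v uv].
- by apply: le_anti; have := pq p; have := pq q; rewrite !inE !lexx => -> <-.
- by rewrite inE add0r lez_nat ltz_nat /= (leq_ltn_trans _ ltPk)//
    -[X in (_ <= X)%N]card_ord max_card.
- by apply: imsetS; apply/fintype.subsetP => q; rewrite !inE => /le_trans; apply.
Qed.

Lemma e_numberP d (P : finPOrderType d) : (0 < #|P|)%N ->
  levels_free P (e_number P) /\ forall k, levels_free P k -> (k <= e_number P)%N.
Proof.
move=> P0; rewrite /e_number; case: xgetP => // none.
pose p k := `[< levels_free P k >].
have exp : exists k, p k by exists 0%N; apply/asboolP/levels_free0.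
have ubp k : p k -> (k <= #|P|)%N by move/asboolP/levels_free_bound.
case: (ex_maxnP exp ubp) => m /asboolP Pm maxm.
by case: (none m); split=> // k' /asboolP; apply: maxm.
Qed.

Definition is_chain n (C : {set {set 'I_n}}) : bool :=
  [forall A in C, forall B in C, (A \subset B) || (B \subset A)].

Definition full_chains n : {set {set {set 'I_n}}} :=
  [set C | maxset (@is_chain n) C].

Definition lubell (R : realType) n (F : {set {set 'I_n}}) : R :=
  (\sum_(C in full_chains n) #|F :&: C|%:R) / #|full_chains n|%:R.

Definition lower_L_bounded (R : realType) d (P : finPOrderType d) : Prop :=
  forall beta eps : R, 2^-1 < beta < 1 -> 0 < eps ->
  exists N : nat, forall n : nat, (N <= n)%N ->
  forall F : {set {set 'I_n}}, poset_free F P ->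
    (forall A, A \in F -> #|A|%:R < beta * n%:R) ->
    lubell R F <= (e_number P)%:R + eps.

Section Wedge.
Context (d : Order.disp_t) (k : nat) (P : 'I_k -> finBPOrderType d).

(* None is the common bottom; Some (Tagged _ x) is a nonbottom x in one P i. *)
Definition wedge : Type :=
  option {i : 'I_k & {x : P i | x != \bot%O}}.

HB.instance Definition _ := Finite.on wedge.

Definition wedge_le (u v : wedge) : bool :=
  match u, v with
  | None, _ => true
  | Some _, None => false
  | Some a, Some b => (tag a == tag b) &&
      (\val (tagged a) <= \val (tagged_as a b))%O
  end.

Lemma wedge_leE i (x y : {x : P i | x != \bot%O}) :
  wedge_le (Some (Tagged (fun i => {x : P i | x != \bot%O}) x))
           (Some (Tagged (fun i => {x : P i | x != \bot%O}) y))
  = (\val x <= \val y)%O.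
Proof.
by rewrite /wedge_le eqxx (@tagged_asE _ _
  (Tagged (fun i => {x : P i | x != \bot%O}) x)).
Qed.

Lemma wedge_le_refl : reflexive wedge_le.
Proof. by case=> [[i x]|] //; rewrite wedge_leE. Qed.

Lemma wedge_le_anti : antisymmetric wedge_le.
Proof.
case=> [[i x]|] [[j y]|] // /andP[xy yx].
have /andP[/eqP /= ij _] := xy; subst j.
move: xy yx; rewrite !wedge_leE => xy yx; congr (Some (Tagged _ _)).
by apply: val_inj; apply: le_anti; rewrite xy.
Qed.

Lemma wedge_le_trans : transitive wedge_le.
Proof.
case=> [[j y]|] [[i x]|] [[l z]|] // xy yz.
have /andP[/eqP /= ij _] := xy; have /andP[/eqP /= jl _] := yz; subst i l.
by move: xy yz; rewrite !wedge_leE => xy /(le_trans xy); rewrite -wedge_leE.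
Qed.

HB.instance Definition _ :=
  Order.Le_isPOrder.Build d wedge wedge_le_refl wedge_le_anti wedge_le_trans.

Definition wedge_in (i : 'I_k) (x : P i) : wedge :=
  omap (Tagged (fun i => {x : P i | x != \bot%O})) (insub x).

Lemma wedge_in_bot i : wedge_in (\bot%O : P i) = None.
Proof. by rewrite /wedge_in insubF ?eqxx. Qed.

Lemma wedge_in_le i (x y : P i) : (wedge_in x <= wedge_in y)%O = (x <= y)%O.
Proof.
have [->|x0] := eqVneq x \bot%O; first by rewrite wedge_in_bot le0x.
have [->|y0] := eqVneq y \bot%O.
  by rewrite wedge_in_bot lex0 (negPf x0) /wedge_in insubT.
by rewrite /wedge_in !insubT [LHS]wedge_leE.
Qed.

Lemma wedge_in_le_neq i j (x : P i) (y : P j) : i != j ->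
  (wedge_in x <= wedge_in y)%O = (x == \bot%O).
Proof.
move=> ij; have [->|x0] := eqVneq x \bot%O; first by rewrite wedge_in_bot.
rewrite /wedge_in insubT; case: insubP => //= u _ _.
by rewrite [LHS]/(wedge_le _ _) /= (negPf ij).
Qed.

Lemma wedge_in_surj (u : wedge) :
  u = None \/ exists i (x : P i), u = wedge_in x.
Proof.
case: u => [[i x]|]; [right|by left].
by exists i, (\val x); rewrite /wedge_in valK.
Qed.

End Wedge.

(* Main.v *)
(* Since each P i embeds in the wedge, e (P i) <= e (wedge P).  Group the full
   chains by their smallest member A in F: the Lubell function of F is at most
   the largest Lubell function of a link of F at some A in F.  If the latter
   exceeded e (wedge P) + eps, the bounded number of sets used by the copies of
   P 0, ..., P (i-1) above A could be deleted, each costing at most 1/(n - |A|)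
   because it lies strictly between A and the ground set, and the link would
   still contain P i, with its bottom movable to A.  All these copies together
   would form the wedge in F. *)

Require Import Defs.
From HB Require Import structures.
From mathcomp Require Import all_boot all_order all_algebra.
From mathcomp Require Import boolp classical_sets reals.
From mathcomp Require Import fintype finset.

Set Implicit Arguments.
Unset Strict Implicit.
Unset Printing Implicit Defensive.

Import Order.TTheory GRing.Theory Num.Theory.

Local Open Scope ring_scope.

(** * Full chains and their symmetry *)

Lemma is_chainP n (C : {set {set 'I_n}}) :
  reflect {in C &, forall A B : {set 'I_n}, (A \subset B) || (B \subset A)} (is_chain C).
Proof.
apply: (iffP forall_inP) => [ch A B AC BC|ch A AC].
  by have /forall_inP/(_ B BC) := ch A AC.
by apply/forall_inP => B; apply: ch.
Qed.

(** Otherwise [A |: C] would be a strictly larger chain, against maximality. *)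
Lemma full_chain_mem n (C : {set {set 'I_n}}) (A : {set 'I_n}) :
  C \in full_chains n ->
  {in C, forall B : {set 'I_n}, (A \subset B) || (B \subset A)} -> A \in C.
Proof.
rewrite inE => /maxsetP[/is_chainP ch mx] cmp.
rewrite -(mx (A |: C)) ?setU11 ?subsetUr //.
apply/is_chainP => X Y /setU1P[->|XC] /setU1P[->|YC]; rewrite ?subxx //.
- exact: cmp.
- by rewrite orbC cmp.
- exact: ch.
Qed.

Lemma full_chain_card_inj n (C : {set {set 'I_n}}) :
  C \in full_chains n -> {in C &, injective (fun A : {set 'I_n} => #|A|)}.
Proof.
rewrite inE => /maxsetP[/is_chainP ch _] A B AC BC AB.
have /orP[s|s] := ch A B AC BC.
  by apply/eqP; rewrite eqEcard s AB /=.
by apply/esym/eqP; rewrite eqEcard s AB /=.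
Qed.

(** Let [A] be a largest member of size at most [i] and [B] a smallest one of size at least [i]. If
    [A] were too small, adding to it a point of [B] outside [A] would give a set comparable to all
    of [C], hence a member of [C], contradicting the choice of [A]. *)
Lemma full_chain_level n (C : {set {set 'I_n}}) i :
  C \in full_chains n -> (i <= n)%N -> exists2 A, A \in C & #|A| = i.
Proof.
move=> fC le_in.
have C0 : set0 \in C by apply: full_chain_mem => // B _; rewrite sub0set.
have CT : [set: 'I_n] \in C.
  by apply: full_chain_mem => // B _; rewrite subsetT orbT.
pose lo := [pred X : {set 'I_n} | (X \in C) && (#|X| <= i)%N].
pose hi := [pred X : {set 'I_n} | (X \in C) && (i <= #|X|)%N].
have p0 : lo set0 by rewrite /= C0 cards0.
have pT : hi [set: 'I_n] by rewrite /= CT cardsT card_ord.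
case: (arg_maxnP (fun X : {set 'I_n} => #|X|) p0) => A /andP[AC lA] maxA.
case: (arg_minnP (fun X : {set 'I_n} => #|X|) pT) => B /andP[BC lB] minB.
have ch : {in C &, forall X Y : {set 'I_n}, (X \subset Y) || (Y \subset X)}.
  by move: fC; rewrite inE => /maxsetP[/is_chainP].
have sub X Y : X \in C -> Y \in C -> (#|X| <= #|Y|)%N -> X \subset Y.
  move=> XC YC le; have /orP[//|s] := ch X Y XC YC.
  by have /eqP -> : Y == X by rewrite eqEcard s.
have [ge|gt] := leqP i #|A|.
  by exists A => //; apply/eqP; rewrite eqn_leq lA.
have AB : A \proper B by rewrite properEcard sub ?(leq_trans lA) ?(leq_trans gt).
have [_ [x xB xA]] := properP AB.
suff /maxA : lo (x |: A).
  by rewrite cardsU1 xA /= add1n ltnn.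
rewrite /= cardsU1 xA add1n gt andbT.
apply: full_chain_mem => // X XC; have [le|lt] := leqP #|X| i.
  rewrite [X in _ || X](subset_trans (sub X A XC AC _)) ?orbT ?subsetUr //.
  by apply: maxA; rewrite /= XC.
have BX : B \subset X by apply: sub => //; apply: minB; rewrite /= XC ltnW.
by rewrite (subset_trans _ BX) // subUset sub1set xB proper_sub.
Qed.

Lemma exists_full_chain n : exists C, C \in full_chains n.
Proof.
have ch0 : is_chain (set0 : {set {set 'I_n}}).
  by apply/is_chainP => A B; rewrite inE.
by have [C mC _] := maxset_exists ch0; exists C; rewrite inE.
Qed.

(** List each set followed by its complement, and match the two lists position by position. *)
Lemma inj_imset_eq_card (T : finType) (A B : {set T}) :
  #|A| = #|B| -> exists2 f : T -> T, injective f & f @: A = B.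
Proof.
move=> AB; pose e (X : {set T}) := enum X ++ enum (~: X).
have e_uniq X : uniq (e X).
  rewrite cat_uniq !enum_uniq andbT /=; apply/hasPn => x.
  by rewrite !mem_enum inE.
have e_mem X x : x \in e X by rewrite mem_cat !mem_enum inE orbN.
have e_size X : size (e X) = #|T| by rewrite size_cat -!cardE cardsC.
pose f x := nth x (e B) (index x (e A)).
have f_inj : injective f.
  move=> x y; rewrite /f (set_nth_default x) ?e_size -?(e_size A) ?index_mem //.
  move/eqP; rewrite nth_uniq ?e_size -?(e_size A) ?index_mem // => /eqP.
  by apply: index_inj.
exists f => //; apply/eqP; rewrite eqEcard (card_imset _ f_inj) AB leqnn andbT.
apply/subsetP => _ /imsetP[x xA ->].
have lt : (index x (enum A) < size (enum B))%N.
  by rewrite -cardE -AB cardE index_mem mem_enum.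
by rewrite /f /e index_cat mem_enum xA nth_cat lt -mem_enum mem_nth.
Qed.

Lemma full_chains_imset n (f : 'I_n -> 'I_n) (C : {set {set 'I_n}}) :
  injective f -> C \in full_chains n ->
  [set f @: A | A : {set 'I_n} in C] \in full_chains n.
Proof.
have ch_im (h : 'I_n -> 'I_n) (D : {set {set 'I_n}}) :
    is_chain D -> is_chain [set h @: A | A : {set 'I_n} in D].
  move/is_chainP => ch; apply/is_chainP => _ _ /imsetP[A AD ->] /imsetP[B BD ->].
  by have /orP[s|s] := ch A B AD BD; rewrite (imsetS _ s) ?orbT.
move=> f_inj; have [g fK gK] := injF_bij f_inj.
have imK h h' (D : {set {set 'I_n}}) : cancel h' h ->
    [set h @: A | A : {set 'I_n} in [set h' @: A | A : {set 'I_n} in D]] = D.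
  move=> hK; rewrite -imset_comp -[RHS]imset_id; apply: eq_imset => A /=.
  by rewrite -imset_comp -[RHS]imset_id; apply: eq_imset => x /=.
rewrite !inE => /maxsetP[ch mx]; apply/maxsetP; split; first exact: ch_im.
move=> D chD sub; rewrite -(imK f g D gK); congr (imset _ _).
by rewrite (mx _ (ch_im g D chD)) // -(imK g f C fK) imsetS.
Qed.

(** * Counting chains through a set; the binomial form of the Lubell function *)

Definition chains_through n (B : {set 'I_n}) :=
  [set C in full_chains n | B \in C].

Lemma card_chains_through_eq n (A B : {set 'I_n}) :
  #|A| = #|B| -> #|chains_through A| = #|chains_through B|.
Proof.
suff le (X Y : {set 'I_n}) : #|X| = #|Y| ->
    (#|chains_through X| <= #|chains_through Y|)%N.
  by move=> AB; apply/eqP; rewrite eqn_leq !le.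
move=> /inj_imset_eq_card[f f_inj <-].
rewrite -(card_imset (mem (chains_through X)) (imset_inj (imset_inj f_inj))).
apply: subset_leq_card; apply/subsetP => _ /imsetP[C /setIdP[fC XC] ->].
by rewrite inE full_chains_imset //= imset_f.
Qed.

(** Double counting: every full chain has exactly one member of size [#|B|], and by symmetry all
    sets of that size lie on equally many full chains. *)
Lemma card_chains_through n (B : {set 'I_n}) :
  (#|chains_through B| * 'C(n, #|B|) = #|full_chains n|)%N.
Proof.
have le_Bn : (#|B| <= n)%N by rewrite -[X in (_ <= X)%N]card_ord max_card.
transitivity (\sum_(A : {set 'I_n} | #|A| == #|B|) #|chains_through A|)%N.
  rewrite (eq_bigr (fun=> #|chains_through B|)); last first.
    by move=> A /eqP; apply: card_chains_through_eq.
  rewrite sum_nat_const mulnC -[X in 'C(X, _)]card_ord -card_draws.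
  by congr (_ * _)%N; apply: eq_card => A; rewrite inE.
under eq_bigr do rewrite -sum1_card big_mkcond.
rewrite exchange_big -[RHS]sum1_card [RHS]big_mkcond; apply: eq_bigr => C _ /=.
under eq_bigr do rewrite inE.
case: ifPn => fC /=; last by rewrite big1.
have [A AC cA] := full_chain_level fC le_Bn.
rewrite (bigD1 A) ?cA //= AC big1 // => X /andP[/eqP cX XA].
case: ifPn => // XC; case/eqP: XA.
by apply: (full_chain_card_inj fC) => //; rewrite cX cA.
Qed.

Lemma lubellE (R : realType) n (F : {set {set 'I_n}}) :
  lubell R F = \sum_(B in F) ('C(n, #|B|))%:R^-1.
Proof.
have [C0 fC0] := exists_full_chain n.
have N0 : #|full_chains n|%:R != 0 :> R.
  by rewrite pnatr_eq0 -lt0n; apply/card_gt0P; exists C0.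
rewrite /lubell -natr_sum.
have -> : (\sum_(C in full_chains n) #|F :&: C| =
           \sum_(B in F) #|chains_through B|)%N.
  transitivity (\sum_(C in full_chains n) \sum_(B in F) (B \in C))%N.
    apply: eq_bigr => C _; rewrite -sum1_card big_mkcond [RHS]big_mkcond.
    by apply: eq_bigr => B _; rewrite inE; do 2!case: (B \in _).
  rewrite exchange_big; apply: eq_bigr => B _ /=.
  rewrite -sum1_card big_mkcond [RHS]big_mkcond.
  by apply: eq_bigr => C _; rewrite [in RHS]inE; do 2!case: (_ \in _).
rewrite natr_sum mulr_suml; apply: eq_bigr => B _.
rewrite -(card_chains_through B) natrM invfM mulrA divff ?mul1r //.
by move: N0; rewrite -(card_chains_through B) natrM mulf_eq0 => /norP[].
Qed.

(** * Lubell functions of links *)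

(* The Lubell function of the link of F at D (lubell_link), written inside 'I_n
   so that links at different D can be compared. *)
Definition link_sum (R : realType) n (F : {set {set 'I_n}}) (D : {set 'I_n}) : R :=
  \sum_(B in F | D \subset B) ('C(n - #|D|, #|B| - #|D|))%:R^-1.

Lemma lubell_link_sum (R : realType) n (F : {set {set 'I_n}}) :
  lubell R F = link_sum R F set0.
Proof.
rewrite lubellE /link_sum cards0 subn0.
by apply: eq_big => [B|B _]; rewrite ?sub0set ?andbT ?subn0.
Qed.

(* Condition a random full chain starting at D on its second member. *)
Lemma link_sum_avg (R : realType) n (F : {set {set 'I_n}}) (D : {set 'I_n}) :
  D \notin F ->
  (n - #|D|)%:R * link_sum R F D = \sum_(x in ~: D) link_sum R F (x |: D).
Proof.
move=> DF; rewrite /link_sum mulr_sumr.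
under [RHS]eq_bigr do rewrite big_mkcondr.
rewrite exchange_big /= big_mkcondr /=; apply: eq_bigr => B BF.
rewrite -big_mkcondr /=; case: ifPn => [DB|DB]; last first.
  rewrite big_pred0 // => x; apply/negP => /andP[_].
  by rewrite subUset (negPf DB) andbF.
have DpB : (#|D| < #|B|)%N.
  by apply: proper_card; rewrite properEneq DB andbT; apply: contraNneq DF => ->.
have le_Bn : (#|B| <= n)%N by rewrite -[X in (_ <= X)%N]card_ord max_card.
rewrite (eq_bigl (mem (B :\: D))); last first.
  by move=> x; rewrite !inE subUset sub1set DB andbT.
rewrite (eq_bigr (fun=> ('C((n - #|D|).-1, (#|B| - #|D|).-1))%:R^-1)); last first.
  by move=> x /setDP[_ xD]; rewrite cardsU1 xD add1n !subnS.
rewrite sumr_const cardsD (setIidPr DB).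
(* There are [b] choices of [x] in [B :\: D], so the terms at [B] agree by the absorption identity
   [a * 'C(a.-1, b.-1) = b * 'C(a, b)]. *)
set a := (n - _)%N; set b := (_ - _)%N.
have b0 : (0 < b)%N by rewrite subn_gt0.
have ba : (b <= a)%N by rewrite leq_sub2r.
have := mul_bin_diag a b.-1; rewrite prednK // => /(congr1 (fun i => i%:R : R)).
rewrite !natrM => E.
have c0 : 'C(a, b)%:R != 0 :> R by rewrite pnatr_eq0 -lt0n bin_gt0.
have c1 : 'C(a.-1, b.-1)%:R != 0 :> R.
  by rewrite pnatr_eq0 -lt0n bin_gt0 -ltnS !prednK // (leq_trans b0).
by rewrite -[RHS]mulr_natl; apply/eqP; rewrite eqr_div ?E.
Qed.

(** Induction on the size of the complement of [D]: outside [F], the sum at [D] is the average of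
    the sums at the sets [x |: D]. The condition [0 <= c] handles the ground set, whose sum is empty
    when it is not in [F]. *)
Lemma link_sum_le (R : realType) n (F : {set {set 'I_n}}) (c : R) :
  0 <= c -> (forall A, A \in F -> link_sum R F A <= c) ->
  forall D, link_sum R F D <= c.
Proof.
move=> c0 Fc D; have [m] := ubnP #|~: D|; elim: m D => // m IH D ltm.
have [DF|DF] := boolP (D \in F); first exact: Fc.
have cD : #|~: D| = (n - #|D|)%N by rewrite cardsCs setCK card_ord.
have [DT|] := posnP #|~: D|.
  rewrite /link_sum big_pred0 // => B; apply/negP => /andP[BF].
  have -> : D = [set: 'I_n] by apply/setC_inj/eqP; rewrite setCT -cards_eq0 DT.
  rewrite subTset => /eqP BT; case/negP: DF.
  suff -> : D = B by [].
  by rewrite BT; apply/setC_inj/eqP; rewrite setCT -cards_eq0 DT.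
move=> pos; rewrite -(ler_pM2l (_ : 0 < (n - #|D|)%:R)); last by rewrite ltr0n -cD.
rewrite link_sum_avg // -cD mulr_natl -sumr_const.
apply: ler_sum => x; rewrite inE => xD; apply: IH.
rewrite -ltnS (leq_trans _ ltm) // ltnS.
by apply: proper_card; rewrite properC properE subsetUr subUset sub1set (negPf xD).
Qed.

Lemma leq_bin n m : (0 < m < n)%N -> (n <= 'C(n, m))%N.
Proof.
elim: n m => // n IH [|m] // /andP[_]; rewrite ltnS => mn.
have [->|lt] := eqVneq m.+1 n; first by rewrite binSn.
by rewrite binS -addn1; apply: leq_add; rewrite ?bin_gt0 ?(ltnW mn) // IH //= ltn_neqAle lt.
Qed.

(** A deleted set lies strictly between [A] and the ground set, so its binomial coefficient is an
    interior one and is at least [n - #|A|] by [leq_bin]. *)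
Lemma link_sum_setD (R : realType) n (F G : {set {set 'I_n}}) (A : {set 'I_n}) :
  (forall B, B \in G -> A \proper B /\ B \proper [set: 'I_n]) ->
  link_sum R F A <= link_sum R (F :\: G) A + #|G|%:R / #|~: A|%:R.
Proof.
move=> AG; rewrite /link_sum (bigID (mem G)) /= addrC lerD //.
  by rewrite le_eqVlt; apply/orP; left; apply/eqP/eq_bigl => B;
    rewrite inE andbC andbA.
have cA : #|~: A| = (n - #|A|)%N by rewrite cardsCs setCK card_ord.
rewrite -mulr_natl mulr1 mulr_natl -sumr_const.
rewrite [leRHS](bigID [pred B | (B \in F) && (A \subset B)]) /=.
rewrite (eq_bigl (fun B => (B \in G) && ((B \in F) && (A \subset B)))); last first.
  by move=> B; rewrite andbC.
rewrite ler_wpDr ?sumr_ge0 // => [B _|]; first by rewrite invr_ge0.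
apply: ler_sum => B /andP[/AG[AB BT] _].
have lA := proper_card AB; have lB := proper_card BT.
rewrite cardsT card_ord in lB.
have a0 : (0 < n - #|A|)%N by rewrite subn_gt0 (ltn_trans lA).
have ba : (#|B| - #|A| < n - #|A|)%N by rewrite ltn_sub2r // (ltn_trans lA).
have b0 : (0 < #|B| - #|A|)%N by rewrite subn_gt0.
rewrite cA lef_pV2 ?posrE ?ltr0n ?bin_gt0 ?(ltnW ba) // ler_nat.
by rewrite leq_bin // b0.
Qed.

(** * Links as families on a smaller ground set *)

(** The complement of [A] is renumbered by [enum_val], so that a link is again a family on an
    ordinal and [lower_L_bounded] applies to it. *)
Definition extend n (A : {set 'I_n}) (X : {set 'I_#|~: A|}) : {set 'I_n} :=
  A :|: [set enum_val i | i in X].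

Definition link n (F : {set {set 'I_n}}) (A : {set 'I_n}) : {set {set 'I_#|~: A|}} :=
  [set X | extend X \in F].

Lemma extendK n (A : {set 'I_n}) :
  cancel (@extend n A) (fun B => [set i | enum_val i \in B]).
Proof.
move=> X; apply/setP => i; rewrite !inE mem_imset; last exact: enum_val_inj.
by have := enum_valP i; rewrite inE => /negPf ->.
Qed.

Lemma restrictK n (A B : {set 'I_n}) :
  A \subset B -> extend (A := A) [set i | enum_val i \in B] = B.
Proof.
move=> AB; apply/setP => x; rewrite inE; have [xA|xA] /= := boolP (x \in A).
  by rewrite (subsetP AB).
have xA' : x \in ~: A by rewrite inE.
apply/imsetP/idP => [[i]|xB]; first by rewrite inE => ? ->.
by exists (enum_rank_in xA' x); rewrite ?inE enum_rankK_in.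
Qed.

Lemma card_extend n (A : {set 'I_n}) (X : {set 'I_#|~: A|}) :
  #|extend X| = (#|A| + #|X|)%N.
Proof.
rewrite cardsU disjoint_setI0 ?cards0 ?subn0 ?card_imset //; first exact: enum_val_inj.
rewrite disjoint_sym disjoints_subset; apply/subsetP => _ /imsetP[i _ ->].
exact: enum_valP.
Qed.

Lemma lubell_link (R : realType) n (F : {set {set 'I_n}}) (A : {set 'I_n}) :
  lubell R (link F A) = link_sum R F A.
Proof.
rewrite lubellE /link_sum.
rewrite [RHS](reindex_onto (@extend n A) (fun B => [set i | enum_val i \in B])); last first.
  by move=> B /andP[_ AB]; rewrite restrictK.
apply: eq_big => [X|X _]; first by rewrite inE extendK subsetUl eqxx !andbT.
have cA : #|~: A| = (n - #|A|)%N by rewrite cardsCs setCK card_ord.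
by rewrite card_extend addKn -cA.
Qed.

(** * Building the wedge above a common bottom *)

Definition embeds_above n (F : {set {set 'I_n}}) (A : {set 'I_n}) d
    (P : finBPOrderType d) (f : P -> {set 'I_n}) :=
  [/\ f \bot%O = A, injective f, forall p, f p \in F
    & forall u v, (u <= v)%O -> f u \subset f v].

(** Only the bottom can be sent to the empty set in the link, since the image of the bottom is
    contained in all images. The other points thus extend to proper supersets of [A], and the bottom
    can be moved to [A]. *)
Lemma link_contains_embeds n (F : {set {set 'I_n}}) (A : {set 'I_n}) d
    (P : finBPOrderType d) :
  A \in F -> contains_poset (link F A) P -> exists f : P -> _, embeds_above F A f.
Proof.
move=> AF [g [g_inj gF g_mono]].
exists (fun p => if p == \bot%O then A else extend (g p)).
have g0 p : p != \bot%O -> g p != set0.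
  apply: contraNneq => gp0; rewrite -(inj_eq g_inj) gp0 eq_sym -subset0 -gp0.
  by rewrite g_mono ?le0x.
have eA p : p != \bot%O -> extend (g p) != A.
  move=> /g0; apply: contraNneq => /(congr1 (fun B : {set _} => #|B|)).
  by rewrite card_extend -[in RHS](addn0 #|A|) => /addnI/eqP; rewrite cards_eq0.
split=> [|p q|p|u v uv]; first by rewrite eqxx.
- case: eqVneq => [->|p0]; case: eqVneq => [->|q0] // e.
  + by case/eqP: (eA q q0).
  + by case/eqP: (eA p p0).
  + exact/g_inj/(can_inj (@extendK n A)).
- by case: eqVneq => // _; have := gF p; rewrite inE.
- case: eqVneq => [_|u0]; first by case: ifP => // _; apply: subsetUl.
  case: eqVneq => [v0|_]; first by move: uv; rewrite v0 lex0 (negPf u0).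
  by rewrite setUS // imsetS // g_mono.
Qed.

(** Greedy choice: the copies of the [P i] are picked one after the other, each avoiding the
    nonbottom points of all earlier ones. The total number of points of the [P i] bounds what has to
    be avoided. *)
Lemma embeds_above_wedge n (F : {set {set 'I_n}}) (A : {set 'I_n})
    d k (P : 'I_k -> finBPOrderType d) : A \in F ->
  (forall (i : 'I_k) (G : {set {set 'I_n}}),
     (#|G| <= #|{: {i : 'I_k & P i}}|)%N ->
     (forall B, B \in G -> B \in F /\ A \proper B) ->
     exists f : P i -> _, embeds_above (F :\: G) A f) ->
  contains_poset F (wedge P).
Proof.
move=> AF avoid.
have /(_ k (leqnn k))[f [f_emb f_disj]] : forall m, (m <= k)%N ->
    exists f : forall i, P i -> {set 'I_n},
    (forall i : 'I_k, (i < m)%N -> embeds_above F A (f i)) /\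
    (forall i j : 'I_k, (i < j < m)%N -> forall (p : P i) (q : P j),
       p != \bot%O -> q != \bot%O -> f i p != f j q).
  elim=> [_|m IH mk].
    by exists (fun _ _ => set0); split=> // i j; rewrite ltn0 andbF.
  have [f [f_emb f_disj]] := IH (ltnW mk).
  pose G := [set f (tag t) (tagged t) |
    t : {i : 'I_k & P i} & (tag t < m)%N && (tagged t != \bot%O)].
  have cG : (#|G| <= #|{: {i : 'I_k & P i}}|)%N.
    exact: leq_trans (leq_imset_card _ _) (max_card _).
  have [|g [g0 g_inj gF g_mono]] := avoid (Ordinal mk) G cG.
    move=> B /imsetP[[i p]]; rewrite inE => /andP[/= im p0] ->.
    have [f0 f_inj fF f_mono] := f_emb i im; split=> //.
    by rewrite properEneq -f0 f_mono ?le0x ?andbT // (inj_eq f_inj) eq_sym.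
  (* The function at index [m] is replaced by the new copy [g]; the others are kept. *)
  exists (dfwith f g); split=> [i|i j /andP[ij]].
    case: dfwithP => [_|j ji jm].
      by split=> // p; have := gF p; rewrite inE => /andP[].
    by apply: f_emb; rewrite ltn_neqAle -ltnS jm andbT eq_sym.
  rewrite ltnS => jm p q p0 q0.
  case: (dfwithP f g i) p p0 ij => [p _|i' ni p p0 ij].
    by rewrite ltnNge /= jm.
  case: (dfwithP f g j) q q0 jm ij => [q _ _ im|j' nj q q0 jm ij].
    have := gF q; rewrite inE => /andP[+ _]; apply: contraNneq => <-.
    by apply/imsetP; exists (Tagged (fun i => P i : Type) p) => //; rewrite inE /= im.
  by apply: f_disj; rewrite // ij ltn_neqAle jm andbT eq_sym.
exists (fun u : wedge P => if u is Some (existT i p) then f i (\val p) else A).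
have f0 i : f i \bot%O = A by have [] := f_emb i (ltn_ord i).
have f_inj i : injective (f i) by have [] := f_emb i (ltn_ord i).
have fA i (p : {x : P i | x != \bot%O}) : f i (\val p) != A.
  by rewrite -(f0 i) (inj_eq (f_inj i)) (valP p).
split.
- case=> [[i p]|] [[j q]|] //= /eqP; last by rewrite eq_sym (negPf (fA _ _)).
    have [ij|ij|/val_inj ij] := ltngtP i j.
    + by rewrite (negPf (f_disj _ _ _ _ _ (valP p) (valP q))) // ij ltn_ord.
    + by rewrite eq_sym (negPf (f_disj _ _ _ _ _ (valP q) (valP p))) // ij ltn_ord.
    + by case: _ / ij q => q; rewrite (inj_eq (f_inj i)) => /eqP/val_inj ->.
  by rewrite (negPf (fA _ _)).
- by case=> [[i p]|] //=; have [_ _ fF _] := f_emb i (ltn_ord i).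
- case=> [[i p]|] [[j q]|] //= uv.
    have /andP[/eqP /= ij _] := uv; case: _ / ij q uv => q.
    rewrite [(_ <= _)%O]wedge_leE.
    by have [_ _ _ f_mono] := f_emb i (ltn_ord i); apply: f_mono.
  by have [f0' _ _ f_mono] := f_emb j (ltn_ord j); rewrite -f0' f_mono ?le0x.
Qed.

(** * The wedge is lower-L-bounded *)

Lemma contains_poset_wedge n (F : {set {set 'I_n}}) d k
    (P : 'I_k -> finBPOrderType d) (i : 'I_k) :
  contains_poset F (wedge P) -> contains_poset F (P i).
Proof.
case=> g [g_inj gF g_mono]; exists (fun p => g (wedge_in p)); split=> //.
- by move=> p q /g_inj e; apply: le_anti; rewrite -!wedge_in_le e lexx.
- by move=> u v uv; apply: g_mono; rewrite wedge_in_le.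
Qed.

Lemma e_number_wedge d k (P : 'I_k -> finBPOrderType d) (i : 'I_k) :
  (e_number (P i) <= e_number (wedge P))%N.
Proof.
have P0 : (0 < #|P i|)%N by apply/card_gt0P; exists \bot%O.
have W0 : (0 < #|{: wedge P}|)%N by apply/card_gt0P; exists None.
apply: (e_numberP W0).2 => n s /(contains_poset_wedge i).
exact: (e_numberP P0).1.
Qed.

Theorem theorem7p2 (R : realType) (d : Order.disp_t) (k : nat)
    (k_gt0 : (0 < k)%N) (P : 'I_k -> finBPOrderType d)
    (P_bounded : forall i : 'I_k, lower_L_bounded R (P i)) :
  lower_L_bounded R (wedge P).
Proof.
move=> beta eps beta12 eps0; have /andP[_ beta1] := beta12.
have eps2 : 0 < eps / 2 by rewrite divr_gt0.
have [N N_P] := fin_all_exists (fun i => P_bounded i beta (eps / 2) beta12 eps2).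
(* [K] bounds the number of deleted sets. A complement of [A] of size at least [M] is large enough
   for every [N i], is nonempty, and makes the deletion cost at most [eps / 2]. Since
   [#|A| < beta * n], taking [n] at least [y] forces that size. *)
pose K := #|{: {i : 'I_k & P i}}|.
pose x : R := K%:R / (eps / 2).
pose M := maxn (\max_i N i) (Num.bound x).+1.
pose y : R := M%:R / (1 - beta).
have b0 : 0 < 1 - beta by rewrite subr_gt0.
have y0 : 0 <= y by rewrite divr_ge0 // ltW.
have x0 : 0 <= x by rewrite divr_ge0 // ltW.
exists (Num.bound y) => n le_n F F_free F_small; rewrite lubell_link_sum.
(* The ground set is too large to be in [F], so deleted sets are proper, as the cost estimate
   demands. *)
have F_proper B : B \in F -> B \proper [set: 'I_n].
  move=> /F_small lt; rewrite properT; apply: contraTneq lt => ->.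
  by rewrite cardsT card_ord -leNgt ler_piMl // ltW.
apply: link_sum_le => [|A AF]; first by rewrite addr_ge0 // ltW.
rewrite leNgt; apply/negP => A_big; apply: F_free.
apply: (embeds_above_wedge AF) => i G cG GF.
have cA : n%:R = #|A|%:R + #|~: A|%:R :> R by rewrite -natrD cardsC card_ord.
have le_M : (M <= #|~: A|)%N.
  rewrite -(ler_nat R) -(ler_pM2r (_ : 0 < (1 - beta)^-1)) ?invr_gt0 // -/y.
  have yn : y <= n%:R.
    by rewrite (le_trans (ltW (archi_boundP y0))) // ler_nat.
  apply: (le_trans yn); rewrite ler_pdivlMr // mulrBr mulr1 mulrC lerBlDr.
  by rewrite {1}cA addrC lerD2l ltW // F_small.
have AF' : A \in F :\: G.
  by rewrite inE AF andbT; apply/negP => /GF[_]; rewrite properxx.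
(* If the link after deletion were free of [P i], its Lubell function would be at most
   [e_number (P i) + eps / 2]; restoring [G] adds at most [eps / 2], which contradicts [A_big]. *)
apply: link_contains_embeds => //; apply: contrapT => H_free.
have le_N : (N i <= #|~: A|)%N.
  by apply: leq_trans le_M; rewrite leq_max (leq_bigmax i).
have := N_P i _ le_N _ H_free; rewrite lubell_link => bound.
(* The same [beta] works in the link: removing [A] lowers the size by [#|A|] but the bound by only
   [beta * #|A|]. *)
have H_small (X : {set 'I_#|~: A|}) : X \in link (F :\: G) A ->
    #|X|%:R < beta * #|~: A|%:R.
  rewrite !inE => /andP[_ /F_small].
  rewrite card_extend natrD cA mulrDr -ltrBrDl => /lt_le_trans; apply.
  by rewrite lerBlDl lerD2r ler_piMl // ltW.
have KA : #|G|%:R / #|~: A|%:R <= eps / 2.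
  have A0 : 0 < #|~: A|%:R :> R.
    by rewrite ltr0n (leq_trans _ le_M) // leq_max orbT.
  rewrite ler_pdivrMr // mulrC -ler_pdivrMr //.
  apply: (@le_trans _ _ x); first by rewrite ler_pM2r ?invr_gt0 // ler_nat.
  apply: (le_trans (ltW (archi_boundP x0))); rewrite ler_nat.
  by apply: leq_trans le_M; rewrite leq_max leqnSn orbT.
have: link_sum R F A <= (e_number (P i))%:R + eps / 2 + eps / 2.
  apply: le_trans (lerD (bound H_small) KA); apply: link_sum_setD => B BG.
  by have [BF AB] := GF B BG; split=> //; apply: F_proper.
rewrite leNgt -addrA -splitr (le_lt_trans _ A_big) //.
by rewrite lerD2r ler_nat e_number_wedge.
Qed.
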